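(* Let $d,n$ be positive integers with $d\le n$. Then $\mathcal{C}_d\subseteq\mathbb{Z}_{2^n}$ is $d$-cube-free, and every $d$-cube-free set $S\subseteq\mathbb{Z}_{2^n}$ that is a union of some of the layers $L_1,\dots,L_{n+1}$ satisfies $|S|\le|\mathcal{C}_d|$.
   Context: All arithmetic is in $\mathbb{Z}_{2^n}$. For a multiset $S=\{a_1,\dots,a_d\}$ of $d$ (not necessarily distinct) elements, $\Sigma^*S=\{\sum_{i\in I}a_i:\emptyset\ne I\subseteq[d]\}$ (as a set) is the projective $d$-cube it generates; a set $A$ is $d$-cube-free if there is no multiset $S$ of size $d$ with $\Sigma^*S\subseteq A$. Layers: for $1\le i\le n$, $L_i=\{x\in\mathbb{Z}_{2^n}: x\equiv 2^{i-1}\pmod{2^i}\}$, $L_{n+1}=\{0\}$. Construction: define index sets $I_d\subseteq\mathbb{Z}_{>0}$ recursively by $I_1=\emptyset$ and, for $d\ge2$, with $\ell$ the largest integer such that $2^\ell\le d$, $I_d=\{1,\dots,\ell\}\cup\{j+\ell+1: j\in I_{d-2^\ell+1}\}$. Then $\mathcal{C}_d=\bigcup_{i\in I_d}L_i$ (for $d\le n$ all indices in $I_d$ are at most $n$). Equivalently, $\mathcal{C}_1=\emptyset$ and $\mathcal{C}_d=L_1\cup\dots\cup L_\ell\cup\{2^{\ell+1}x: x\in\mathcal{C}_{d-2^\ell+1}\}$. *)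

(* Defs.v *)
(* Z_{2^n} is rendered as 'Z_(2^n) (n >= 1 so 2^n >= 2). *)
From mathcomp Require Import all_boot all_order all_algebra.
Set Implicit Arguments. Unset Strict Implicit. Unset Printing Implicit Defensive.
Import GRing.Theory.
Local Open Scope ring_scope.

Definition layer (n i : nat) : {set 'Z_(2^n)} :=
  if i == n.+1 then [set 0]
  else [set x : 'Z_(2^n) | ((val x) %% 2 ^ i == 2 ^ (i - 1))%N].

(* The index sets I_d, computed with fuel (fuel d suffices since d - 2^l + 1 < d). *)
Fixpoint Iidx_fuel (f d : nat) : seq nat :=
  match f with
  | 0 => [::]
  | f'.+1 =>
      if (d < 2)%N then [::]
      else let l := trunc_log 2 d in
           iota 1 l ++ map (fun j => (j + l + 1)%N) (Iidx_fuel f' (d - 2 ^ l + 1))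
  end.

Definition Iidx (d : nat) : seq nat := Iidx_fuel d d.

Definition Cset (n d : nat) : {set 'Z_(2^n)} := \bigcup_(i <- Iidx d) layer n i.

(* Sigma^* S for the multiset S = {a_1,...,a_d} given as a d-indexed family. *)
Definition Sigma_star (n d : nat) (a : 'I_d -> 'Z_(2^n)) : {set 'Z_(2^n)} :=
  [set \sum_(i in I) a i | I : {set 'I_d} & I != set0].

Definition cube_free (n d : nat) (A : {set 'Z_(2^n)}) : Prop :=
  forall a : 'I_d -> 'Z_(2^n), ~ (Sigma_star a \subset A).

Definition layer_union (n : nat) (S : {set 'Z_(2^n)}) : Prop :=
  exists J : seq nat, all (fun i => (1 <= i <= n.+1)%N) J /\
                      S = \bigcup_(i <- J) layer n i.
Arguments cube_free : clear implicits.
Arguments layer_union : clear implicits.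

(* Main.v *)
Require Import Defs.
From mathcomp Require Import all_boot all_order all_algebra all_fingroup cyclic zify.

Set Implicit Arguments. Unset Strict Implicit. Unset Printing Implicit Defensive.
Import GRing.Theory.
Local Open Scope ring_scope.

(** Freeness.  Let 2^l <= d < 2^(l+1).  In Z_(2^(l+1)), a sequence of d terms
    none of whose subset sums is h = 2^l contains d - 2^l + 1 disjoint zero-sum
    blocks; dividing their sums by 2^(l+1) gives a cube of dimension
    d - 2^l + 1, and induction applies.  To find the blocks, add minus the total
    as an extra term and split into minimal zero-sum blocks U.  Each U has at
    least 2|U| - 1 subset sums, these numbers add up along the blocks as in
    Kneser's theorem (every nontrivial subgroup contains h, so no stabilizer
    occurs), and altogether there are at most 2^(l+1) - 1 subset sums.

    Optimality.  Layers 1, ..., l+1 contain the d-cube of d equal odd numbers, and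
    2^l - 1 ones followed by 2^(l+1) times a cube of dimension d - 2^l + 1 form a
    d-cube.  Hence the greedy set I_d is lexicographically first among the index
    sets of d-cube-free unions, which is what maximizes the size. *)

(** Walking up from any point of [P] must leave [P] before [n]. These exits all coincide in one
    point [j], so no point of [P] lies above [j]; a gap below [j] would create an earlier exit,
    since [P 0] holds. *)
Lemma unique_exit_interval (P : pred nat) i n :
    P 0%N -> P i -> (i <= n)%N -> ~~ P n ->
    (forall c c', (c < n)%N -> (c' < n)%N ->
      P c -> ~~ P c.+1 -> P c' -> ~~ P c'.+1 -> c = c') ->
  exists j, [/\ (i <= j)%N, (j < n)%N & forall c, (c <= n)%N -> P c = (c <= j)%N].
Proof.
move=> P0 Pi le_in NPn exit1.
have first_exit c : (c <= n)%N -> P c ->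
    exists j, [/\ (c <= j)%N, (j < n)%N, P j & ~~ P j.+1].
  move=> le_cn; rewrite -(subKn le_cn); move: (n - c)%N (leq_subr c n) => k.
  elim: k => [|k IHk] le_kn Pc; first by rewrite subn0 (negbTE NPn) in Pc.
  have nk : ((n - k.+1).+1 = n - k)%N by lia.
  have [Pc1|NPc1] := boolP (P (n - k)%N).
    by have [|j [le_j lt_j Pj NPj]] := IHk _ Pc1; [lia | exists j; split=> //; lia].
  by exists (n - k.+1)%N; split=> //; [lia | rewrite nk].
have [j [le_ij lt_jn Pj NPj]] := first_exit i le_in Pi.
exists j; split=> // c le_cn; apply/idP/idP => [Pc|].
  have [j' [le_cj' lt_j'n Pj' NPj']] := first_exit c le_cn Pc.
  by rewrite (exit1 j j').
elim: c le_cn => // c IHc lt_cn lt_cj; apply/negPn/negP => NPc.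
have Pc : P c by apply: IHc; exact: ltnW.
by move: lt_cj; rewrite (exit1 c j) // ltnn.
Qed.

(** * Subset sums in groups whose cyclic subgroups form a chain *)

Definition sumset (G : finZmodType) (A B : {set G}) : {set G} :=
  [set x + y | x in A, y in B].

Definition subset_sums (G : finZmodType) (T : finType) (a : T -> G)
    (B : {set T}) : {set G} :=
  [set \sum_(i in J) a i | J : {set T} in powerset B].

Section CyclicTwoGroup.

Variables (G : finZmodType) (h : G).
Hypothesis chain : forall x y : G, (exists c, y = x *+ c) \/ (exists c, x = y *+ c).
Hypothesis h_order2 : h + h = 0.

Lemma eq_mulrn_mod_order (x : G) i j :
  (x *+ i == x *+ j) = (i == j %[mod #[x]%g])%N.
Proof. by rewrite -!FinRing.zmodXgE eq_expg_mod_order. Qed.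

Lemma mulrn_order_eq0 (x : G) : x *+ #[x]%g = 0.
Proof. by rewrite -FinRing.zmodXgE expg_order. Qed.

(** If instead [b] is a multiple of [h], then [h + h = 0] leaves only [b = h]. *)
Lemma involution_mulrn (b : G) : b != 0 -> exists k, h = b *+ k.
Proof.
move=> b0; case: (chain b h) => // -[c bE].
exists 1%N; rewrite mulr1n; move: b0; rewrite bE.
rewrite -(odd_double_half c) -mul2n mulrnDr mulrnA mulr2n h_order2 mul0rn addr0.
by case: (odd c); rewrite ?mulr1n ?mulr0n ?eqxx.
Qed.

(* Dyson's e-transform: replacing (A, B) by (A u (B + e), B n (A - e)) with
   e in A keeps the total size and shrinks the sumset, until A + B = A; then A
   is a union of cosets of the subgroup generated by B, and this subgroup
   contains h unless B = {0}. *)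
Lemma card_sumset (A B : {set G}) :
  0 \in A -> 0 \in B -> h \notin sumset A B ->
  (#|A| + #|B| <= #|sumset A B| + 1)%N.
Proof.
have [n leBn] := ubnP #|B|; elim: n => // n IHn in A B leBn *.
move=> A0 B0 hAB.
have AsubAB : A \subset sumset A B.
  by apply/subsetP=> x xA; apply/imset2P; exists x 0; rewrite ?addr0.
have [/forall_inP clo|] := boolP [forall (e | e \in A), [forall (b | b \in B), b + e \in A]].
  have [BE|[b]] := set_0Vmem (B :\ 0).
    by rewrite [#|B|](cardsD1 0) B0 BE cards0 addn0 leq_add2r subset_leq_card.
  rewrite !inE => /andP[b0 bB].
    have {}clo e : e \in A -> b + e \in A.
      by move=> eA; apply: (forall_inP (clo e eA)).
    have bnA k : b *+ k \in A.
      by elim: k => [|k IHk]; rewrite ?mulr0n // mulrS clo.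
  by have [k hE] := involution_mulrn b0; rewrite hE (subsetP AsubAB) in hAB.
rewrite negb_forall_in => /exists_inP[e eA].
rewrite negb_forall_in => /exists_inP[b bB bnA].
pose A' := A :|: [set x + e | x in B].
pose B' := [set x in B | x + e \in A].
have B'sub : B' \subset B by apply/subsetP=> x; rewrite inE => /andP[].
have ltB' : (#|B'| < #|B|)%N.
  rewrite proper_card // properE B'sub; apply/subsetPn; exists b => //.
  by rewrite inE bB (negbTE bnA).
have inj_e : injective (fun x : G => x + e) by exact: addIr.
have AB' : sumset A' B' \subset sumset A B.
  apply/subsetP=> z /imset2P[x y]; rewrite !inE => /orP[xA|/imsetP[u uB ->]] /andP[yB yA] ->.
    by apply/imset2P; exists x y.
  by apply/imset2P; exists (y + e) u => //; rewrite addrC addrA addrAC -addrA addrC.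
have cardE : (#|A'| + #|B'| = #|A| + #|B|)%N.
  have -> : #|B'| = #|A :&: [set x + e | x in B]|.
    rewrite -(card_imset _ inj_e); apply: eq_card => z; rewrite !inE.
    apply/imsetP/andP => [[x]|[zA /imsetP[x xB zE]]].
      by rewrite inE => /andP[xB xA] ->; split => //; apply: imset_f.
    by exists x => //; rewrite inE xB -zE.
  by rewrite cardsUI (card_imset _ inj_e).
rewrite -cardE; apply: leq_trans (IHn _ _ _ _ _ _) _.
- exact: leq_trans ltB' _.
- by rewrite inE A0.
- by rewrite inE B0 add0r.
- by apply: contraNN hAB; apply: (subsetP AB').
- by rewrite leq_add2r subset_leq_card.
Qed.

Lemma opp_mulrn (x : G) e : exists c, - (x *+ e) = x *+ c.
Proof.
exists (e * #[x]%g.-1)%N; apply/eqP; rewrite eq_sym -subr_eq0 opprK -mulrnDr.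
by rewrite -mulnSr prednK ?order_gt0 // mulnC mulrnA mulrn_order_eq0 mul0rn.
Qed.

Lemma mulrn_lt_order (x : G) c : exists2 c', (c' < #[x]%g)%N & x *+ c = x *+ c'.
Proof.
exists (c %% #[x]%g)%N; first by rewrite ltn_mod order_gt0.
by apply/eqP; rewrite eq_mulrn_mod_order modn_mod.
Qed.

Lemma mulrn_inj_lt (x : G) c c' :
  (c < #[x]%g)%N -> (c' < #[x]%g)%N -> x *+ c = x *+ c' -> c = c'.
Proof.
by move=> ltc ltc' /eqP; rewrite eq_mulrn_mod_order !modn_small // => /eqP.
Qed.

Lemma opp_mulrn_pred (x : G) : - x = x *+ #[x]%g.-1.
Proof.
apply/eqP; rewrite eq_sym -subr_eq0 opprK -mulrSr prednK ?order_gt0 //.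
by rewrite mulrn_order_eq0.
Qed.

(** * Zero-sum blocks and the number of their subset sums *)

Section Sums.

Variables (T : finType) (a : T -> G).
Implicit Types (A B C J U : {set T}).

Local Notation sum J := (\sum_(i in J) a i).

Lemma mem_subset_sums B J : J \subset B -> sum J \in subset_sums a B.
Proof. by move=> JB; apply/imsetP; exists J; rewrite ?powersetE. Qed.

Lemma subset_sumsP B x :
  reflect (exists2 J : {set T}, J \subset B & x = sum J) (x \in subset_sums a B).
Proof.
by apply: (iffP imsetP) => -[J]; rewrite ?powersetE => JB ->; exists J;
  rewrite ?powersetE.
Qed.

Lemma subset_sums0 B : 0 \in subset_sums a B.
Proof. by apply/subset_sumsP; exists set0; rewrite ?sub0set ?big_set0. Qed.

Lemma subset_sumsS A B : A \subset B -> subset_sums a A \subset subset_sums a B.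
Proof. by move=> AB; rewrite imsetS // powersetS. Qed.

Lemma sumU B C : [disjoint B & C] -> sum (B :|: C) = sum B + sum C.
Proof. by move=> dBC; rewrite -bigU //; apply: eq_bigl => i; rewrite inE. Qed.

Lemma subset_sumsU B C : [disjoint B & C] ->
  subset_sums a (B :|: C) = sumset (subset_sums a B) (subset_sums a C).
Proof.
move=> dBC; apply/setP=> x; apply/subset_sumsP/imset2P => -[].
  move=> J JBC ->; exists (sum (J :&: B)) (sum (J :&: C)); rewrite ?mem_subset_sums ?subsetIr //.
  rewrite -sumU ?(disjointWl (subsetIr _ _)) ?(disjointWr (subsetIr _ _)) //.
  by rewrite -setIUr; move/setIidPl: JBC => ->.
move=> _ _ /subset_sumsP[J JB ->] /subset_sumsP[K KC ->] ->.
exists (J :|: K); first exact: setUSS.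
by rewrite sumU // (disjointWl JB) // (disjointWr KC).
Qed.

Lemma subset_sums1 w : subset_sums a [set w] = [set 0; a w].
Proof.
apply/setP=> x; rewrite !inE; apply/subset_sumsP/orP.
  move=> [J]; rewrite subset1 => /orP[]/eqP-> ->.
    by right; rewrite big_set1.
  by left; rewrite big_set0.
case=> /eqP->; [exists set0|exists [set w]]; by rewrite ?sub0set ?big_set0 ?big_set1.
Qed.

(** Minimal zero-sum sequences, taken as sets of indices so that equal terms stay distinct. *)
Definition minimal_zero_sum U :=
  [/\ U != set0, sum U = 0 &
      forall J, J \subset U -> J != set0 -> sum J = 0 -> J = U].


(** The cyclic subgroups generated by the terms form a finite chain, which has a largest member. *)
Lemma chain_generator U : U != set0 ->
  exists2 w, w \in U & forall v, v \in U -> exists c, a v = a w *+ c.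
Proof.
rewrite -cards_eq0 cardE; have memU v : v \in U = (v \in enum U) by rewrite mem_enum.
move=> nz; suff [w wU wP] : exists2 w, w \in enum U &
    forall v, v \in enum U -> exists c, a v = a w *+ c.
  by exists w => [|v]; rewrite memU //; apply: wP.
elim: (enum U) nz => // u [|u' s] IHs _.
  by exists u => [|v]; rewrite inE // => /eqP->; exists 1%N.
have [//|w ws wP] := IHs.
case: (chain (a u) (a w)) => -[c wE].
  exists u => [|v]; rewrite inE ?eqxx // => /predU1P[->|/wP[c' ->]]; first by exists 1%N.
  by exists (c * c')%N; rewrite wE mulrnA.
exists w => [|v]; first by rewrite inE ws orbT.
by rewrite inE => /predU1P[->|/wP//]; exists c.
Qed.

Lemma subset_card_exists U k : (k <= #|U|)%N -> exists2 J : {set T}, J \subset U & #|J| = k.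
Proof.
move=> leU; exists [set x in take k (enum U)].
  by apply/subsetP=> x; rewrite inE => /mem_take; rewrite mem_enum.
rewrite cardsE (card_uniqP _) ?take_uniq ?enum_uniq // size_takel //.
by rewrite -cardE.
Qed.

(* If every w in W = U \ B enlarges Y = subset_sums a B by at most 1, then y + w
   leaves Y for at most one y in Y.  Let x be a term of W generating the largest
   subgroup.  As - x is not in Y, the multiples of x in Y are 0, ..., j x, and
   then every term of W equals x.  Since sum B is a multiple of x in Y, sum U = 0
   forces 0, ..., (j + |W|) x to run through the whole subgroup, including h. *)
Lemma growth_step U B :
    minimal_zero_sum U -> h \notin subset_sums a U ->
    B \subset U -> B != set0 -> (1 < #|U :\: B|)%N ->
  exists2 w, w \in U :\: B & (#|subset_sums a B| + 2 <= #|subset_sums a (w |: B)|)%N.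
Proof.
move=> [U0 sumU0 minU] hU BU B0 W1; set W := U :\: B; set Y := subset_sums a B.
have dBW : [disjoint B & W] by rewrite /W -setI_eq0 setDE setICA setICr setI0.
have BWU : B :|: W = U by rewrite -{1}(setIidPr BU) setID.
have [/exists_inP[w wW]|] := boolP [exists (w | w \in W),
    (#|Y| + 2 <= #|subset_sums a (w |: B)|)%N]; first by exists w.
rewrite negb_exists_in => /forall_inP small.
have exit1 w y y' : w \in W -> y \in Y -> y' \in Y ->
    y + a w \notin Y -> y' + a w \notin Y -> y = y'.
  move=> wW yY y'Y yw y'w; apply/eqP/negPn/negP => yy'.
  have /negP[] := small w wW.
  have dwB : [disjoint [set w] & B].
    by rewrite disjoints1; move: wW; rewrite inE => /andP[].
  have sub : Y :|: [set y + a w; y' + a w] \subset subset_sums a (w |: B).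
    rewrite subUset subset_sumsS ?subsetUr //= subset_sumsU //.
    apply/subsetP=> z; rewrite !inE => /orP[]/eqP->; rewrite addrC;
      by apply: imset2_f; rewrite // subset_sums1 !inE eqxx orbT.
  apply: leq_trans (subset_leq_card sub).
  suff /eqP dis : Y :&: [set y + a w; y' + a w] == set0.
    by rewrite cardsU dis cards0 subn0 cards2 (inj_eq (addIr _)) yy'.
  rewrite -subset0; apply/subsetP=> z; rewrite !inE.
  by case/andP=> zY /orP[]/eqP zE; move: zY; rewrite zE ?(negbTE yw) ?(negbTE y'w).
(* If [- a w] is the sum over some [J] inside [B], then [w |: J] is a zero-sum subset of [U], hence
   [U] itself, and [W] has only one element. *)
have oppY w : w \in W -> - a w \notin Y.
  move=> wW; apply/negP => /subset_sumsP[J JB JE].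
  have wJ : w \notin J.
    by apply: contraL wW => wJ; rewrite inE negb_and negbK (subsetP JB).
  have UE : w |: J = U.
    apply: minU; last by rewrite sumU ?disjoints1 // big_set1 -JE subrr.
      by rewrite subUset sub1set (subset_trans JB BU) andbT; move: wW; rewrite inE => /andP[].
    by apply/set0Pn; exists w; rewrite setU11.
  suff : (#|W| <= 1)%N by rewrite leqNgt W1.
  rewrite -(cards1 w) subset_leq_card //; apply/subsetP=> v.
  rewrite /W -UE !inE => /andP[vB /orP[//|vJ]].
  by rewrite (subsetP JB) in vB.
have W0 : W != set0 by rewrite -card_gt0 ltnW.
have [w wW genW] := chain_generator W0.
set x := a w in genW; have [o oE] : exists o, o = #[x]%g by exists #[x]%g.
have o_gt0 : (0 < o)%N by rewrite oE order_gt0.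
have sumBW : sum B = - sum W by apply/eqP; rewrite -subr_eq0 opprK -sumU // BWU sumU0.
have [i lt_io BE] : exists2 i, (i < o)%N & sum B = x *+ i.
  have [e WE] : exists e, sum W = x *+ e.
    elim/big_ind: _ => [|_ _ [c ->] [c' ->]|v /genW[c ->]]; first by exists 0%N.
      by exists (c + c')%N; rewrite mulrnDr.
    by exists c.
  rewrite sumBW WE; have [c ->] := opp_mulrn x e; rewrite oE; exact: mulrn_lt_order.
have i_gt0 : (0 < i)%N.
  rewrite lt0n; apply: contraNneq W0 => i0.
  by rewrite /W (minU B) ?setDv // BE i0.
have Y0 : x *+ 0 \in Y by rewrite mulr0n subset_sums0.
have Yi : x *+ i \in Y by rewrite -BE mem_subset_sums.
have Ymax : x *+ o.-1 \notin Y by rewrite oE -opp_mulrn_pred oppY.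
have [j [le_ij lt_jo YE]] : exists j, [/\ (i <= j)%N, (j < o.-1)%N &
    forall c, (c <= o.-1)%N -> (x *+ c \in Y) = (c <= j)%N].
  apply: (unique_exit_interval Y0 Yi) => //; first by rewrite -ltnS prednK.
  move=> c c' lt_co lt_c'o Yc NYc Yc' NYc'.
  apply: (@mulrn_inj_lt x); rewrite -?oE; try by rewrite -(prednK o_gt0) ltnW.
  by apply: (exit1 w); rewrite // -/x -mulrSr.
(* Write [a v = x *+ c] with 0 < c < o. If j + c < o and c > 1, adding [a v] takes both [x *+ j] and
   [x *+ j.-1] out of [Y], against [exit1]. If j + c >= o, then [- a v = x *+ (o - c)] lies in [Y],
   against [oppY]. *)
have constW v : v \in W -> a v = x.
  move=> vW; have [c0 vE0] := genW v vW; have [c] := mulrn_lt_order x c0.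
  rewrite -vE0 -oE => lt_co vE; have Nv := oppY v vW.
  have c_gt0 : (0 < c)%N.
    by rewrite lt0n; apply: contraNneq Nv => c0'; rewrite vE c0' mulr0n oppr0 -(mulr0n x).
  have [lt_jc|le_oc] := ltnP (j + c) o.
    have [c1|c1] := eqVneq c 1%N; first by rewrite vE c1 mulr1n.
    suff /(@mulrn_inj_lt x) : x *+ j = x *+ j.-1.
      by rewrite -oE; clear -le_ij i_gt0 lt_jo; lia.
    have [b1 b2 b3] : [/\ j <= o.-1, j.-1 <= o.-1 & j.-1 <= j]%N.
      by clear -lt_jo; split; lia.
    have [b4 b5] : (j + c <= o.-1)%N /\ (j.-1 + c <= o.-1)%N.
      by clear -lt_jc; split; lia.
    have [b6 b7] : ~~ (j + c <= j)%N /\ ~~ (j.-1 + c <= j)%N.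
      by clear -c_gt0 c1 le_ij i_gt0; split; lia.
    by apply: (exit1 v); rewrite // ?vE -?mulrnDr YE.
  case/negP: Nv; suff -> : - a v = x *+ (o - c).
    by rewrite YE; clear -le_oc c_gt0 o_gt0; lia.
  apply/eqP; rewrite eq_sym -subr_eq0 opprK vE -mulrnDr subnK ?oE ?mulrn_order_eq0 //.
  by rewrite -oE ltnW.
have addW y k : y \in Y -> (k <= #|W|)%N -> y + x *+ k \in subset_sums a U.
  move=> yY /subset_card_exists[J JW <-].
  rewrite -BWU subset_sumsU //; apply: imset2_f => //.
  rewrite -sumr_const -(eq_bigr _ (fun v vJ => constW v (subsetP JW v vJ))).
  exact: mem_subset_sums.
(* The total over [U] being 0, i + |W| is a positive multiple of the order of [x]. *)
have le_oW : (o <= i + #|W|)%N.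
  have sumWE : sum W = x *+ #|W| by rewrite -sumr_const; apply: eq_bigr.
  have : (x *+ (i + #|W|) == x *+ 0) by rewrite mulrnDr -BE sumBW sumWE addNr.
  rewrite eq_mulrn_mod_order mod0n -oE => /dvdn_leq; apply.
  by rewrite addn_gt0 i_gt0.
have x0 : x != 0.
  by apply: contraNneq (oppY w wW) => x0; rewrite -/x x0 oppr0 subset_sums0.
have [k0 hE0] := involution_mulrn x0; have [k] := mulrn_lt_order x k0.
rewrite -hE0 -oE => lt_ko hE.
(* Multiples of [x] up to j lie in [Y]; the later ones are [x *+ i] plus at most |W| terms equal to
   [x]. *)
case/negP: hU; rewrite hE; have [le_kj|lt_jk] := leqP k j.
  by rewrite (subsetP (subset_sumsS BU)) // YE // -ltnS prednK.
rewrite -(subnKC (leq_trans le_ij (ltnW lt_jk))) mulrnDr addW //.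
by clear -lt_ko le_oW; lia.
Qed.

(** One nonzero term has two subset sums, and [growth_step] gains two more per added term until a
    single term is left. For that last term [card_sumset] still gains one. *)
Lemma card_minimal_zero_sum U :
    minimal_zero_sum U -> h \notin subset_sums a U ->
  (2 * #|U| <= #|subset_sums a U| + 1)%N.
Proof.
move=> minUP hU; have [U0 _ minU] := minUP.
have a_neq0 u : (1 < #|U|)%N -> u \in U -> a u != 0.
  move=> U1 uU; apply/eqP => au0; move: U1.
  by rewrite -(minU [set u]) ?cards1 ?sub1set ?big_set1 // -card_gt0 cards1.
have [U1|leU1] := ltnP 1 #|U|; last first.
  have : (0 < #|subset_sums a U|)%N by apply/card_gt0P; exists 0; exact: subset_sums0.
  by clear -leU1; lia.
have grow k : (0 < k)%N -> (k < #|U|)%N ->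
    exists B : {set T}, [/\ B \subset U, #|B| = k & (2 * k <= #|subset_sums a B|)%N].
  elim: k => // -[_ _ _|k IHk _ ltkU].
    have [u uU] := set0Pn _ U0; exists [set u].
    by rewrite sub1set cards1 subset_sums1 cards2 eq_sym a_neq0.
  have [//|B [BU cB leB]] := IHk _ (ltnW ltkU).
  have B0 : B != set0 by rewrite -card_gt0 cB.
  have W1 : (1 < #|U :\: B|)%N.
    by rewrite cardsD (setIidPr BU) cB ltn_subRL addn1.
  have [w] := growth_step minUP hU BU B0 W1.
  rewrite inE => /andP[wB wU] leY; exists (w |: B); split.
  - by rewrite subUset sub1set wU.
  - by rewrite cardsU1 wB cB.
  - by move: leB leY; clear; lia.
have [||B [BU cB leB]] := grow #|U|.-1; [by rewrite ltn_predRL | by rewrite ltn_predL ltnW|].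
have [w wU wB] : exists2 w, w \in U & w \notin B.
  by apply/subsetPn/negP => /subset_leq_card; rewrite cB leqNgt ltn_predL ltnW.
have dwB : [disjoint [set w] & B] by rewrite disjoints1.
have wBU : w |: B \subset U by rewrite subUset sub1set wU.
have hwB : h \notin sumset (subset_sums a [set w]) (subset_sums a B).
  by rewrite -subset_sumsU //; apply: contra hU; apply/subsetP/subset_sumsS.
have := card_sumset (subset_sums0 _) (subset_sums0 _) hwB.
rewrite -subset_sumsU // subset_sums1 cards2 eq_sym a_neq0 //.
move: leB (subset_leq_card (subset_sumsS wBU)) U1; clear; lia.
Qed.

(** Split off a proper zero-sum subset as long as there is one; its complement is again zero-sum.
    The bound survives because [card_sumset] loses only 1 when the two counts of subset sums are
    added. *)
Lemma zero_sum_partition B :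
    sum B = 0 -> h \notin subset_sums a B ->
  exists P : {set {set T}},
    [/\ trivIset P, set0 \notin P, cover P = B,
        forall C, C \in P -> sum C = 0 &
        (2 * #|B| + 1 <= #|subset_sums a B| + 2 * #|P|)%N].
Proof.
have [n leBn] := ubnP #|B|; elim: n => // n IHn in B leBn *.
move=> sumB hB.
have S0 C : (0 < #|subset_sums a C|)%N by apply/card_gt0P; exists 0; exact: subset_sums0.
have [B0|B0] := eqVneq B set0.
  exists set0; split; rewrite ?inE //.
  - by apply/trivIsetP => C D; rewrite inE.
  - by rewrite /cover big_set0 B0.
  - by move=> C; rewrite inE.
  - by have := S0 B; rewrite B0 !cards0; clear; lia.
have [/existsP[J /and4P[JB J0 JneB /eqP sumJ]]|min] :=
    boolP [exists J : {set T}, [&& J \subset B, J != set0, J != B & sum J == 0]].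
  have JDB : J :|: (B :\: J) = B by rewrite -{1}(setIidPr JB) setID.
  have dJ : [disjoint J & B :\: J] by rewrite -setI_eq0 setDE setICA setICr setI0.
  have sumD : sum (B :\: J) = 0 by move: sumB; rewrite -{1}JDB sumU // sumJ add0r.
  have DB : B :\: J \subset B by exact: subsetDl.
  have hJ : h \notin subset_sums a J by apply: contra hB; apply/subsetP/subset_sumsS.
  have hD : h \notin subset_sums a (B :\: J) by apply: contra hB; apply/subsetP/subset_sumsS.
  have cJ : (#|J| < #|B|)%N by rewrite proper_card // properEneq JneB.
  have cB : (#|B| = #|J| + #|B :\: J|)%N by rewrite -(cardsID J B) (setIidPr JB).
  have J_gt0 : (0 < #|J|)%N by rewrite card_gt0.
  have [|P [tP P0 cP zP leP]] := IHn J _ sumJ hJ; first exact: leq_trans cJ leBn.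
  have [|Q [tQ Q0 cQ zQ leQ]] := IHn (B :\: J) _ sumD hD.
    by apply: leq_trans (leBn : (#|B| <= n)%N); rewrite cB -[X in (X < _)%N]add0n ltn_add2r.
  have dPQ : [disjoint P & Q].
    rewrite -setI_eq0 -subset0; apply/subsetP=> C; rewrite inE => /andP[CP CQ].
    have : C \subset J :&: (B :\: J).
      by rewrite subsetI -{1}cP -cQ /cover (bigcup_sup C) //= (bigcup_sup C).
    by rewrite (disjoint_setI0 dJ) subset0 => /eqP C0; rewrite C0 (negbTE P0) in CP.
  exists (P :|: Q); split.
  - by apply: trivIsetU; rewrite // cP cQ.
  - by rewrite inE negb_or P0.
  - by rewrite /cover bigcup_setU -/(cover P) -/(cover Q) cP cQ.
  - by move=> C; rewrite inE => /orP[/zP|/zQ].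
  have hsum : h \notin sumset (subset_sums a J) (subset_sums a (B :\: J)).
    by rewrite -subset_sumsU // JDB.
  have := card_sumset (subset_sums0 _) (subset_sums0 _) hsum.
  rewrite -subset_sumsU // JDB cardsU (disjoint_setI0 dPQ) cards0.
  by move: leP leQ cB; clear; lia.
have minB : minimal_zero_sum B.
  split=> // J JB J0 sumJ; apply/eqP; apply: contraNT min => JneB.
  by apply/existsP; exists J; rewrite JB J0 JneB sumJ eqxx.
exists [set B]; split.
- by apply/trivIsetP => C D; rewrite !inE => /eqP-> /eqP->; rewrite eqxx.
- by rewrite inE eq_sym.
- by rewrite /cover big_set1.
- by move=> C; rewrite inE => /eqP->.
- by have := card_minimal_zero_sum minB hB; rewrite cards1; clear; lia.
Qed.

End Sums.
(* Adding -(sum A) as an extra term makes the total zero; the new subset sums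
   are opposites of old ones, so h = - h is still avoided. *)
Lemma disjoint_zero_sums (T : finType) (a : T -> G) (A : {set T}) M :
    #|G| = (2 * M)%N -> h \notin subset_sums a A ->
  exists P : {set {set T}},
    [/\ trivIset P, set0 \notin P, cover P \subset A,
        forall C, C \in P -> \sum_(i in C) a i = 0 &
        (#|A| + 1 <= #|P| + M)%N].
Proof.
move=> cG hA; pose b := oapp a (- \sum_(i in A) a i).
pose B := None |: [set Some x | x in A].
have someJ (J : {set option T}) : J :\ None = [set Some x | x in Some @^-1: J].
  apply/setP=> -[x|]; rewrite !inE /=.
    by rewrite mem_imset ?inE //; exact: Some_inj.
  by apply/esym/negbTE/negP => /imsetP[].
have sum_some (J : {set T}) : \sum_(i in [set Some x | x in J]) b i = \sum_(i in J) a i.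
  by rewrite big_imset //= => x y _ _ [].
have NoneA (J : {set T}) : None \notin [set Some x | x in J] by apply/negP => /imsetP[].
have preB (J : {set option T}) : J \subset B -> Some @^-1: J \subset A.
  move=> /subsetP JB; apply/subsetP=> x; rewrite inE => /JB.
  by rewrite !inE /= mem_imset //; exact: Some_inj.
have sumB : \sum_(i in B) b i = 0 by rewrite big_setU1 //= sum_some addNr.
have hB : h \notin subset_sums b B.
  apply: contra hA => /subset_sumsP[J JB hE]; have JA := preB J JB.
  have [NJ|NJ] := boolP (None \in J).
    have : h = - h by apply/eqP; rewrite -subr_eq0 opprK h_order2.
    rewrite {2}hE (big_setD1 None) //= someJ sum_some => ->.
    rewrite (big_setID (Some @^-1: J) (A := A)) (setIidPr JA) /=.
    by rewrite opprD opprK addrAC subrr add0r mem_subset_sums // subsetDl.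
  have JE : J :\ None = J.
    by apply/setP=> x; rewrite !inE; case: eqP => // ->; rewrite (negbTE NJ).
  by rewrite hE -JE someJ sum_some mem_subset_sums.
have [Q [tQ Q0 cQ zQ leQ]] := zero_sum_partition sumB hB.
have NB : None \in cover Q by rewrite cQ setU11.
(* The block containing the extra term is discarded; the others consist of original terms. *)
pose C0 := pblock Q None; have C0Q : C0 \in Q by rewrite pblock_mem.
have NC C : C \in Q :\ C0 -> None \notin C.
  rewrite inE => /andP[neC CQ]; apply: contra neC => NCin.
  by rewrite inE -(def_pblock tQ CQ NCin).
have preK C : C \in Q :\ C0 -> [set Some x | x in Some @^-1: C] = C.
  move=> /NC NCn; rewrite -someJ; apply/setP=> x; rewrite !inE.
  by case: eqP => // ->; rewrite (negbTE NCn).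
exists [set Some @^-1: (C : {set option T}) | C in Q :\ C0]; split.
- apply/trivIsetP=> _ _ /imsetP[C CQ ->] /imsetP[D DQ ->] neCD.
  have neq : C != D by apply: contraNneq neCD => ->.
  have := trivIsetP tQ C D; rewrite (subsetP (subsetDl _ _) _ CQ) (subsetP (subsetDl _ _) _ DQ).
  move=> /(_ isT isT neq); rewrite -!setI_eq0 => /eqP CD.
  by rewrite -preimsetI CD preimset0.
- apply/imsetP=> -[C CQ C0E]; have := preK C CQ; rewrite -C0E imset0 => CE.
  by move: CQ; rewrite -CE !inE (negbTE Q0) andbF.
- apply/bigcupsP=> _ /imsetP[C CQ ->]; apply: preB; rewrite -cQ.
  by apply: (bigcup_sup C); rewrite // (subsetP (subsetDl _ _) _ CQ).
- move=> _ /imsetP[C CQ ->]; rewrite -sum_some preK //.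
  by apply: zQ; rewrite (subsetP (subsetDl _ _) _ CQ).
rewrite card_in_imset; last by move=> C D CQ DQ /= E; rewrite -(preK C) // -(preK D) // E.
have cB : #|B| = #|A|.+1 by rewrite cardsU1 NoneA card_imset //; exact: Some_inj.
(* As [h] is missed, there are at most 2M - 1 subset sums. *)
have ltS : (#|subset_sums b B| < #|G|)%N.
  by rewrite -cardsT proper_card // properT; apply: contraNneq hB => ->; rewrite inE.
have := cardsD1 C0 Q; rewrite C0Q.
move: leQ ltS; rewrite cB cG add1n.
by move: #|A| #|Q| #|subset_sums b B| #|Q :\ C0| => ? ? ? ?; clear; lia.
Qed.

End CyclicTwoGroup.

(** * Cube-freeness of C_d *)

(** The gcds of [x] and [y] with the modulus are powers of 2, so one divides the other; by Bezout
    the element with the smaller gcd generates the other one. *)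
Lemma Z2_chain k (x y : 'Z_(2 ^ k.+1)) : (exists c, y = x *+ c) \/ (exists c, x = y *+ c).
Proof.
have N_gt0 : (0 < 2 ^ k.+1)%N by rewrite expn_gt0.
have mulrn_gcd (u v : nat) : (gcdn (2 ^ k.+1) u %| v)%N ->
    exists c, (v%:R : 'Z_(2 ^ k.+1)) = u%:R *+ c.
  move=> /dvdnP[q ->]; have [a _ dvdN] := Bezoutl u N_gt0.
  have [c cE] := opp_mulrn (u%:R : 'Z_(2 ^ k.+1)) a.
  exists (c * q)%N; rewrite [RHS]mulrnA -cE mulnC natrM -[RHS]mulr_natr; congr (_ * _).
  apply/eqP; rewrite -subr_eq0 opprK -mulrnA -natrD mulnC.
  by apply/eqP/val_inj; rewrite /= val_Zp_nat ?(ltn_exp2l 0) //; apply/eqP.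
rewrite -[x]natr_Zp -[y]natr_Zp.
have [[i _ xE] [j _ yE]] : (exists2 i, i <= k.+1 & gcdn (2 ^ k.+1) x = 2 ^ i)%N /\
    (exists2 j, j <= k.+1 & gcdn (2 ^ k.+1) y = 2 ^ j)%N.
  by split; apply/dvdn_pfactor; rewrite // dvdn_gcdl.
have [le_ij|/ltnW le_ji] := leqP i j; [left|right]; apply: mulrn_gcd.
  by rewrite xE (dvdn_trans (dvdn_exp2l 2 le_ij)) // -yE dvdn_gcdr.
by rewrite yE (dvdn_trans (dvdn_exp2l 2 le_ji)) // -xE dvdn_gcdr.
Qed.

Lemma natr_Z2_eq k (u v : nat) :
  ((u%:R : 'Z_(2 ^ k.+1)) == v%:R) = (u == v %[mod 2 ^ k.+1])%N.
Proof. by rewrite -val_eqE /= !val_Zp_nat ?(ltn_exp2l 0). Qed.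

Lemma trunc_log2_spec d : (1 < d)%N ->
  [/\ (0 < trunc_log 2 d)%N, (2 ^ trunc_log 2 d <= d)%N, (d < 2 ^ (trunc_log 2 d).+1)%N
    & (1 < 2 ^ trunc_log 2 d)%N].
Proof.
move=> d1; have /andP[l1 l2] : (2 ^ trunc_log 2 d <= d < 2 ^ (trunc_log 2 d).+1)%N.
  by apply: trunc_log_bounds; rewrite // ltnW.
have l0 : (0 < trunc_log 2 d)%N by case: (trunc_log 2 d) l2 d1 => //; rewrite expn1; lia.
by split=> //; rewrite (ltn_exp2l 0).
Qed.

Lemma Iidx_fuelE f d : (d <= f)%N -> Iidx_fuel f d = Iidx d.
Proof.
rewrite /Iidx; suff fuel g g' e : (e <= g)%N -> (e <= g')%N -> Iidx_fuel g e = Iidx_fuel g' e.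
  by move=> ?; apply: fuel.
elim: g g' e => [|g IHg] [|g'] e //=.
- by rewrite leqn0 => /eqP->.
- by move=> _; rewrite leqn0 => /eqP->.
move=> leg leg'; case: ltnP => // e1; have [_ l1 _ l2] := trunc_log2_spec e1.
by congr (_ ++ map _ _); apply: IHg; move: l1 l2 leg leg'; clear; lia.
Qed.

Lemma IidxE d : (1 < d)%N ->
  Iidx d = iota 1 (trunc_log 2 d) ++
    [seq (j + trunc_log 2 d + 1)%N | j <- Iidx (d - 2 ^ trunc_log 2 d + 1)].
Proof.
move=> d1; have [_ l1 _ l2] := trunc_log2_spec d1.
rewrite {1}/Iidx; case: d d1 l1 l2 => // d d1 l1 l2.
rewrite [LHS]/= ltnNge d1 /=; congr (_ ++ map _ _); apply: Iidx_fuelE.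
by move: l1 l2; clear; lia.
Qed.

Lemma Iidx_le1 d : (d <= 1)%N -> Iidx d = [::].
Proof. by case: d => [|[|d]]. Qed.

Lemma Iidx_ind (Q : nat -> Prop) :
    (forall d, (d <= 1)%N -> Q d) ->
    (forall d, (1 < d)%N -> Q (d - 2 ^ trunc_log 2 d + 1)%N -> Q d) ->
  forall d, Q d.
Proof.
move=> Q1 Qrec d; have [n] := ubnP d; elim: n d => // n IHn d ltdn.
have [/Q1//|d1] := leqP d 1; apply: Qrec => //; apply: IHn.
by have [_ l1 _ l2] := trunc_log2_spec d1; move: ltdn l1 l2; clear; lia.
Qed.

Lemma Iidx_gt0 d i : i \in Iidx d -> (0 < i)%N.
Proof.
elim/Iidx_ind: d i => d d1 => [|IHd] i; first by rewrite Iidx_le1.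
by rewrite IidxE // mem_cat mem_iota => /orP[/andP[]//|/mapP[j _ ->]]; rewrite addn1.
Qed.

Lemma Iidx_uniq d : uniq (Iidx d).
Proof.
elim/Iidx_ind: d => d d1 => [|IHd]; first by rewrite Iidx_le1.
rewrite IidxE // cat_uniq iota_uniq map_inj_uniq ?IHd ?andbT /=; last first.
  by move=> x y /=; lia.
by apply/hasPn => _ /mapP[j _ ->]; rewrite mem_iota; lia.
Qed.

Lemma Iidx_le d i : i \in Iidx d -> (i <= d)%N.
Proof.
elim/Iidx_ind: d i => d d1 => [|IHd] i; first by rewrite Iidx_le1.
have [l0 l1 l2 l3] := trunc_log2_spec d1.
(* The recursion bounds indices by (d - 2^l + 1) + l + 1, which is at most d only if l + 2 <= 2^l.
   This fails for l = 1, so d = 2, 3 are evaluated directly. *)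
have [d3|d4] := leqP d 3.
  by apply/allP: i; case: d d1 d3 {IHd l0 l1 l2 l3} => [|[|[|[|]]]].
have l_ge2 : (1 < trunc_log 2 d)%N.
  by rewrite ltnNge; apply/negP => le1; move: l2 d4; rewrite (_ : trunc_log 2 d = 1)%N //; lia.
have : (trunc_log 2 d + 2 <= 2 ^ trunc_log 2 d)%N.
  move: l_ge2; clear; elim: (trunc_log 2 d) => // -[|[|n]] // IHn _.
  by rewrite expnS; have := IHn isT; lia.
rewrite IidxE // mem_cat mem_iota => le_l /orP[|/mapP[j /IHd le_j ->]].
  by move: l1 le_l; clear; lia.
by move: le_j le_l l1; clear; lia.
Qed.

(** Terms are natural numbers, so that block sums can be divided by 2^(l+1), and the index type is
    arbitrary, because in the recursion the blocks themselves become the indices. *)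
Lemma Iidx_cube_free d (T : finType) (a : T -> nat) (A : {set T}) :
    (0 < d)%N -> (d <= #|A|)%N ->
  exists J : {set T}, [/\ J \subset A, J != set0 & forall i, i \in Iidx d ->
    ((\sum_(j in J) a j) %% 2 ^ i != 2 ^ (i - 1))%N].
Proof.
elim/Iidx_ind: d T a A => d d1 => [|IHd] T a A d0 ledA.
  exists A; split=> //; first by rewrite -card_gt0 (leq_trans d0).
  by move=> i; rewrite Iidx_le1.
have [l0 l1 l2 l3] := trunc_log2_spec d1; move: IHd; rewrite (IidxE d1).
move: (trunc_log 2 d) l0 l1 l2 l3 => l l0 l1 l2 l3 IHd.
pose h : 'Z_(2 ^ l.+1) := (2 ^ l)%:R; pose b i : 'Z_(2 ^ l.+1) := (a i)%:R.
have h0 : h != 0.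
  rewrite (natr_Z2_eq l _ 0) mod0n modn_small ?ltn_exp2l // -lt0n expn_gt0 //.
have hh : h + h = 0.
  by apply/eqP; rewrite -natrD (natr_Z2_eq l _ 0) addnn -mul2n -expnS modnn mod0n.
have low i x : (0 < i)%N -> (i <= l)%N -> (2 ^ l %| x)%N -> (x %% 2 ^ i != 2 ^ (i - 1))%N.
  move=> i0 le_il dvdx; rewrite (eqP (dvdn_trans (dvdn_exp2l 2 le_il) dvdx)).
  by rewrite eq_sym -lt0n expn_gt0.
(* A subset sum equal to [h] lies in layer l + 1, exactly the one that I_d skips. *)
have [/subset_sumsP[J JA hE]|hA] := boolP (h \in subset_sums b A).
  have JE : (\sum_(j in J) a j = 2 ^ l %[mod 2 ^ l.+1])%N.
    by apply/eqP; rewrite -natr_Z2_eq natr_sum -[X in _ == X]/h hE.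
  exists J; split=> //.
    by apply: contraNneq h0 => J0; rewrite hE J0 big_set0.
  move=> i; rewrite mem_cat mem_iota => /orP[/andP[i0 il]|/mapP[j jI ->]].
    apply: low => //; rewrite /dvdn -(modn_dvdm _ (dvdn_exp2l 2 (leqnSn l))) JE.
    by rewrite modn_dvdm ?dvdn_exp2l // modnn.
  have j0 := Iidx_gt0 jI; apply/eqP => E; move: JE.
  have lj : (l.+1 <= j + l + 1)%N by clear; lia.
  rewrite -(modn_dvdm _ (dvdn_exp2l 2 lj)) E addnK.
  have lj' : (l.+1 <= j + l)%N by move: j0; clear; lia.
  rewrite (eqP (dvdn_exp2l 2 lj')) modn_small ?ltn_exp2l // => /esym/eqP.
  by rewrite expn_eq0.
have cG : #|'Z_(2 ^ l.+1)| = (2 * 2 ^ l)%N.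
  by rewrite card_ord Zp_cast ?(ltn_exp2l 0) // expnS.
have [P [tP P0 cP zP leP]] := disjoint_zero_sums (@Z2_chain l) hh cG hA.
have dvdP C : C \in P -> (2 ^ l.+1 %| \sum_(i in C) a i)%N.
  by move=> /zP/eqP; rewrite -natr_sum (natr_Z2_eq l _ 0) mod0n.
have [||Q [QP Q0 QI]] := IHd _ (fun C : {set T} => (\sum_(i in C) a i) %/ 2 ^ l.+1)%N P.
- by rewrite addn1.
- by rewrite -(leq_add2r (2 ^ l)) addnAC subnK //; apply: leq_trans leP; rewrite leq_add2r.
have sumQ : (\sum_(j in cover Q) a j =
    2 ^ l.+1 * \sum_(C in Q) (\sum_(i in C) a i) %/ 2 ^ l.+1)%N.
  rewrite (big_trivIset _ (trivIsetS QP tP)) /= big_distrr /=; apply: eq_bigr => C CQ.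
  by rewrite mulnC divnK // dvdP // (subsetP QP).
exists (cover Q); split.
- apply: subset_trans cP; apply/bigcupsP => C CQ.
  by apply: (bigcup_sup C); rewrite // (subsetP QP).
- have [C CQ] := set0Pn _ Q0; apply: contraNneq P0 => Q0'.
  by rewrite -(_ : C = set0) ?(subsetP QP) //; apply/eqP; rewrite -subset0 -Q0' (bigcup_sup C).
(* The sum is 2^(l+1) times a number avoiding the layers of the smaller index set: it misses layers
   1 to l by divisibility, and the factor shifts the other indices by l + 1. *)
move=> i; rewrite mem_cat mem_iota sumQ => /orP[/andP[i0 il]|/mapP[j jI ->]].
  by apply: low; rewrite // expnS mulnAC dvdn_mull.
have -> : (2 ^ (j + l + 1) = 2 ^ l.+1 * 2 ^ j)%N by rewrite -expnD; congr (_ ^ _)%N; clear; lia.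
rewrite -muln_modr (_ : j + l + 1 - 1 = l.+1 + (j - 1))%N; last first.
  by move: (Iidx_gt0 jI); clear; lia.
by rewrite expnD eqn_pmul2l ?expn_gt0 // QI.
Qed.

(** * Optimality of I_d *)

(** Layers are read on natural numbers, without reference to n, so that cubes can be rescaled by
    powers of 2. *)
Definition in_layers (s : seq nat) (x : nat) :=
  has (fun i => x %% 2 ^ i == 2 ^ (i - 1))%N s.

Definition has_cube (d : nat) (s : seq nat) :=
  exists a : 'I_d -> nat, forall J : {set 'I_d},
    J != set0 -> in_layers s (\sum_(i in J) a i).

(** The 2-adic valuation of [x] is less than l; halving [x] lowers the layer by one. *)
Lemma in_layers_iota l x : (0 < x)%N -> (x < 2 ^ l)%N -> in_layers (iota 1 l) x.
Proof.
elim: l x => [|l IHl] x x0 lt_x; first by rewrite expn0 in lt_x; case: x x0 lt_x.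
have [od|ev] := boolP (odd x).
  by apply/hasP; exists 1%N; rewrite ?mem_iota //= expn1 modn2 od.
have xE : x = (2 * x./2)%N by rewrite mul2n -[LHS]odd_double_half (negbTE ev).
have /hasP[i] : in_layers (iota 1 l) x./2.
  by apply: IHl; move: x0 lt_x; rewrite {1 2}xE expnS; clear; lia.
rewrite mem_iota => /andP[i0 il] /eqP E; apply/hasP; exists i.+1.
  by rewrite mem_iota; move: il; clear; lia.
rewrite xE expnS -muln_modr E subSS subn0 -expnS; apply/eqP; congr (_ ^ _)%N.
by move: i0; clear; lia.
Qed.

Lemma has_cube_ones d l s : (d < 2 ^ l)%N -> {subset iota 1 l <= s} -> has_cube d s.
Proof.
move=> ltd sub; exists (fun=> 1%N) => J J0; rewrite sum1_card.
have /hasP[i /sub si E] : in_layers (iota 1 l) #|J|.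
  apply: in_layers_iota; first by rewrite card_gt0.
  by apply: leq_ltn_trans ltd; rewrite -[X in (_ <= X)%N]card_ord max_card.
by apply/hasP; exists i.
Qed.

(** Sums have the form x + 2^(l+1) y with x < 2^l. If x > 0, its layer is at most l and the second
    summand does not change it; if x = 0, the layer of y moves up by l + 1. *)
Lemma has_cube_add l d s s' :
    {subset iota 1 l <= s} -> (forall j, j \in s' -> (0 < j)%N /\ (j + l + 1)%N \in s) ->
  has_cube d s' -> has_cube (2 ^ l - 1 + d) s.
Proof.
move=> low high [b bP].
pose a (i : 'I_(2 ^ l - 1 + d)) := if split i is inr k then (2 ^ l.+1 * b k)%N else 1%N.
exists a => J J0.
have sumJ : (\sum_(i in J) a i = #|[set i | lshift d i \in J]| +
    2 ^ l.+1 * \sum_(k in [set k | rshift (2 ^ l - 1) k \in J]) b k)%N.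
  rewrite big_mkcond big_split_ord /= -!big_mkcond /=; congr (_ + _)%N.
    rewrite -sum1_card; apply: eq_big => i; rewrite ?inE // => _.
    by rewrite /a (unsplitK (inl _ i)).
  rewrite big_distrr; apply: eq_big => k; rewrite ?inE // => _.
  by rewrite /a (unsplitK (inr _ k)).
rewrite sumJ; set x := #|_|; set y := bigop _ _ _.
have lt_x : (x < 2 ^ l)%N.
  by apply: leq_ltn_trans (max_card _) _; rewrite card_ord subn1 ltn_predL expn_gt0.
have [x0|x0] := posnP x; last first.
  have /hasP[i il /eqP E] := in_layers_iota x0 lt_x.
  apply/hasP; exists i; first exact: low.
  move: il; rewrite mem_iota => /andP[_ il].
  have dvd : (2 ^ i %| 2 ^ l.+1 * y)%N by rewrite dvdn_mulr // dvdn_exp2l // ltnW.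
  by rewrite -modnDmr (eqP dvd) addn0 E.
have /hasP[j js /eqP E] : in_layers s' y.
  apply: bP; have [i iJ] := set0Pn _ J0; apply/set0Pn.
  case: (split_ordP i) => k ik; last by exists k; rewrite inE -ik.
  by have := cards0_eq x0; move/setP/(_ k); rewrite !inE -ik iJ.
have [j0 sj] := high j js; apply/hasP; exists (j + l + 1)%N => //.
rewrite x0 add0n (_ : j + l + 1 = l.+1 + j)%N; last by clear; lia.
rewrite expnD -muln_modr E -expnD; apply/eqP; congr (_ ^ _)%N.
by move: j0; clear; lia.
Qed.

Lemma sum_iota_pow n l : (l <= n)%N ->
  (\sum_(i <- iota 1 l) 2 ^ (n - i) + 2 ^ (n - l) = 2 ^ n)%N.
Proof.
elim: l => [|l IHl] ltln; first by rewrite big_nil subn0.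
rewrite -(IHl (ltnW ltln)) (_ : iota 1 l.+1 = iota 1 l ++ [:: l.+1]); last first.
  by rewrite -(addn1 l) iotaD add1n addn1.
rewrite big_cat /= big_seq1 -addnA.
by congr (_ + _)%N; rewrite addnn -mul2n -expnS subnSK.
Qed.

Lemma leq_sum_subset (F : nat -> nat) s t : uniq s -> {subset s <= t} ->
  (\sum_(i <- s) F i <= \sum_(i <- t) F i)%N.
Proof.
elim: s t => [|x s IHs] t /=; first by rewrite big_nil.
move=> /andP[xs us] sub; have xt : x \in t by apply: sub; rewrite mem_head.
rewrite big_cons (big_rem x xt) leq_add2l; apply: IHs => // y ys.
have : y \in t by apply: sub; rewrite inE ys orbT.
by rewrite (perm_mem (perm_to_rem xt)) inE => /predU1P[yx|//]; rewrite -yx ys in xs.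
Qed.

(* A layer outweighs the union of all smaller ones, so sizes of unions of layers
   compare as binary numbers. *)
Lemma Iidx_optimal d n s :
    uniq s -> (forall i, i \in s -> (0 < i <= n)%N) ->
    (forall i, i \in Iidx d -> (i <= n)%N) -> ~ has_cube d s ->
  (\sum_(i <- s) 2 ^ (n - i) <= \sum_(i <- Iidx d) 2 ^ (n - i))%N.
Proof.
elim/Iidx_ind: d n s => d d1 => [|IHd] n s us sn In ncube.
  case: s us sn ncube => [|i s] _ sn ncube; first by rewrite big_nil.
  (* Any layer contains a one-term cube, so [s] must be empty. *)
  case: ncube; exists (fun=> 2 ^ (i - 1))%N => J J0; apply/hasP; exists i.
    exact: mem_head.
  rewrite sum_nat_const (_ : #|J| = 1%N) ?mul1n.
    by have /andP[i0 _] := sn i (mem_head i s); rewrite modn_small // ltn_exp2l // subn1 ltn_predL.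
  apply/eqP; rewrite eqn_leq card_gt0 J0 andbT; apply: leq_trans d1.
  by rewrite -[X in (_ <= X)%N]card_ord max_card.
have [l0 l1 l2 l3] := trunc_log2_spec d1; move: IHd In; rewrite (IidxE d1).
move: (trunc_log 2 d) l0 l1 l2 l3 => l l0 l1 l2 l3 IHd In; rewrite big_cat big_map /=.
have le_ln : (l <= n)%N by apply: In; rewrite mem_cat mem_iota l0 add1n ltnSn.
(* If some i <= l is missing, [s] weighs at most 2^n - 1 - 2^(n-i), which is less than the weight
   2^n - 2^(n-l) of the indices 1 to l alone. *)
have [/hasP[i il nis]|/hasPn full] := boolP (has (fun i => i \notin s) (iota 1 l)).
  have le_s : (\sum_(j <- i :: s) 2 ^ (n - j) <= \sum_(j <- iota 1 n) 2 ^ (n - j))%N.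
    apply: leq_sum_subset; rewrite /= ?nis // => j; rewrite mem_iota inE.
    move: il; rewrite mem_iota => /andP[i0 il] /predU1P[->|/sn]; last by rewrite add1n.
    by move: i0 il le_ln; clear; lia.
  have le_li : (2 ^ (n - l) <= 2 ^ (n - i))%N.
    by rewrite leq_exp2l // leq_sub2l //; move: il; rewrite mem_iota add1n => /andP[].
  rewrite big_cons in le_s; apply: leq_trans (leq_addr _ _).
  rewrite -(leq_add2l (2 ^ (n - l))) [leqRHS]addnC sum_iota_pow //.
  rewrite -(sum_iota_pow (leqnn n)); apply: leq_trans (leq_addr _ _).
  by apply: leq_trans le_s; rewrite leq_add2r.
have {}full : {subset iota 1 l <= s} by move=> i /full; rewrite negbK.
have ls : l.+1 \notin s.
  apply/negP => ls; apply: ncube; apply: has_cube_ones l2 _ => i.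
  rewrite -(addn1 l) iotaD mem_cat add1n => /orP[/full//|].
  by rewrite inE => /eqP->.
(* Since l + 1 is not in [s], the indices above l, shifted down by l + 1, stay positive. *)
pose s' := [seq (i - l - 1)%N | i <- s & (l < i)%N].
have sE : [seq i <- s | (l < i)%N] = [seq (j + l + 1)%N | j <- s'].
  rewrite -map_comp -[LHS]map_id; apply/eq_in_map => i; rewrite mem_filter => /andP[li _] /=.
  by move: li; clear; lia.
have low : perm_eq [seq i <- s | ~~ (l < i)%N] (iota 1 l).
  apply: uniq_perm; rewrite ?filter_uniq ?iota_uniq // => i.
  rewrite mem_filter mem_iota -leqNgt add1n ltnS.
  apply/andP/andP => [[il /sn/andP[i0 _]]|[i0 il]]; split=> //.
  by apply: full; rewrite mem_iota i0 add1n ltnS.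
have s'P j : j \in s' -> (0 < j)%N /\ (j + l + 1)%N \in s.
  move=> js; have : (j + l + 1)%N \in [seq i <- s | (l < i)%N] by rewrite sE; apply/mapP; exists j.
  rewrite mem_filter => /andP[_ sj]; split=> //; rewrite lt0n.
  by apply: contraNneq ls => j0; move: sj; rewrite j0 add0n addn1.
rewrite -(perm_big _ (permEl (perm_filterC (fun i => l < i)%N s))) big_cat /=.
rewrite (perm_big _ low) sE big_map addnC leq_add2l.
(* Replacing n by n - l - 1 turns the weights of the shifted indices into those of the induction
   hypothesis. *)
have subE j : (n - (j + l + 1) = n - l.+1 - j)%N by clear; lia.
under eq_bigr do rewrite subE; under [leqRHS]eq_bigr do rewrite subE.
apply: IHd.
- rewrite map_inj_in_uniq ?filter_uniq // => i j; rewrite !mem_filter => /andP[li _] /andP[lj _].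
  by move: li lj; clear; lia.
- by move=> j /s'P[j0 /sn/andP[_ jn]]; rewrite j0; move: jn; clear; lia.
- move=> j jI; have : (j + l + 1 <= n)%N.
    by apply: In; rewrite mem_cat; apply/orP; right; apply/mapP; exists j.
  by clear; lia.
move=> cube; apply: ncube.
have -> : d = (2 ^ l - 1 + (d - 2 ^ l + 1))%N by move: l1 l3; clear; lia.
exact: has_cube_add cube.
Qed.

(** * Layers of Z_(2^n) *)

Lemma in_bigcup_seq (T : finType) (F : nat -> {set T}) s x :
  (x \in \bigcup_(i <- s) F i) = has (fun i => x \in F i) s.
Proof. by elim: s => [|i s IHs]; rewrite ?big_nil ?big_cons inE //= IHs. Qed.

Lemma in_layer n i (x : 'Z_(2 ^ n)) : (i <= n)%N ->
  (x \in layer n i) = (x %% 2 ^ i == 2 ^ (i - 1))%N.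
Proof. by move=> le_in; rewrite /layer ltn_eqF // inE. Qed.

(** For i <= n, reduction modulo 2^n preserves residues modulo 2^i. *)
Lemma in_layers_natr n s x : (0 < n)%N -> (forall i, i \in s -> (i <= n)%N) ->
  (x%:R \in \bigcup_(i <- s) layer n i) = in_layers s x.
Proof.
move=> n0 sn; rewrite in_bigcup_seq; apply: eq_in_has => i /sn le_in.
by rewrite in_layer // val_Zp_nat ?(ltn_exp2l 0) // modn_dvdm // dvdn_exp2l.
Qed.

Lemma card_layer n i : (0 < i <= n)%N -> #|layer n i| = (2 ^ (n - i))%N.
Proof.
move=> /andP[i0 le_in]; have n0 : (0 < n)%N by apply: leq_trans le_in.
pose f (k : 'I_(2 ^ (n - i))) : 'Z_(2 ^ n) := (k * 2 ^ i + 2 ^ (i - 1))%:R.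
have lt_i : (2 ^ (i - 1) < 2 ^ i)%N by rewrite ltn_exp2l // subn1 ltn_predL.
have valf k : f k = (k * 2 ^ i + 2 ^ (i - 1))%N :> nat.
  rewrite /f val_Zp_nat ?(ltn_exp2l 0) // modn_small //.
  rewrite -[X in (_ < 2 ^ X)%N](subnK le_in) expnD; apply: leq_trans (_ : k.+1 * 2 ^ i <= _)%N.
    by rewrite mulSn addnC ltn_add2r.
  by rewrite leq_pmul2r ?expn_gt0.
have inj_f : injective f.
  move=> k k' /(congr1 val); rewrite /= !valf => /addIn /eqP.
  by rewrite eqn_pmul2r ?expn_gt0 // => /eqP /val_inj.
rewrite -[RHS]card_ord -(card_imset _ inj_f); apply: eq_card => x.
rewrite in_layer //; apply/eqP/imsetP => [xE|[k _ ->]].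
  have lt_k : (x %/ 2 ^ i < 2 ^ (n - i))%N.
    by rewrite ltn_divLR ?expn_gt0 // -expnD subnK // -[X in (_ < X)%N](@Zp_cast (2 ^ n)) ?(ltn_exp2l 0).
  exists (Ordinal lt_k) => //; apply: val_inj; rewrite /= valf /= -xE.
  exact: divn_eq.
by rewrite valf modnMDl modn_small.
Qed.

Lemma card_layers n s : uniq s -> (forall i, i \in s -> (0 < i <= n)%N) ->
  #|\bigcup_(i <- s) layer n i| = (\sum_(i <- s) 2 ^ (n - i))%N.
Proof.
elim: s => [|i s IHs] /=; first by rewrite !big_nil cards0.
move=> /andP[nis us] sn; rewrite !big_cons cardsU card_layer ?sn ?mem_head //.
rewrite IHs // => [|j js]; last by rewrite sn // inE js orbT.
rewrite (_ : _ :&: _ = set0) ?cards0 ?subn0 //.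
apply/setP=> x; rewrite in_set0 inE in_bigcup_seq; apply/negP => /andP[xi /hasP[j js xj]].
have /andP[j0 jn] : (0 < j <= n)%N by rewrite sn // inE js orbT.
have /andP[i0 i_n] : (0 < i <= n)%N by rewrite sn // mem_head.
move: xi xj; rewrite !in_layer // => /eqP xi /eqP xj.
(* For p < q, 2^p divides 2^(q-1), so elements of layer q are 0 modulo 2^p. *)
have disj p q : (0 < p)%N -> (p < q)%N -> (x %% 2 ^ p = 2 ^ (p - 1))%N ->
    (x %% 2 ^ q = 2 ^ (q - 1))%N -> False.
  move=> p0 lt_pq xp xq; move: xp; rewrite -(modn_dvdm _ (dvdn_exp2l 2 (ltnW lt_pq))) xq.
  have le_pq : (p <= q - 1)%N by move: lt_pq; clear; lia.
  by rewrite (eqP (dvdn_exp2l 2 le_pq)) => /esym/eqP; rewrite expn_eq0.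
case: (ltngtP i j) => [lt_ij|lt_ji|eq_ij].
- exact: disj lt_ij xi xj.
- exact: disj lt_ji xj xi.
- by rewrite eq_ij js in nis.
Qed.

Lemma sum_val_Zp n (T : finType) (a : T -> 'Z_(2 ^ n)) (J : {set T}) :
  \sum_(i in J) a i = (\sum_(i in J) val (a i))%N%:R.
Proof. by rewrite natr_sum; apply: eq_bigr => i _; rewrite natr_Zp. Qed.

Lemma cube_free_no_cube n d s : (0 < n)%N -> (forall i, i \in s -> (i <= n)%N) ->
  cube_free n d (\bigcup_(i <- s) layer n i) -> ~ has_cube d s.
Proof.
move=> n0 sn free [a aP]; apply: (free (fun i => (a i)%:R)).
apply/subsetP=> _ /imsetP[J J0 ->].
rewrite -natr_sum in_layers_natr //; move: J0; rewrite inE; exact: aP.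
Qed.

Theorem theorem1p10 (d n : nat) :
  (0 < d)%N -> (d <= n)%N ->
  cube_free n d (Cset n d) /\
  (forall S : {set 'Z_(2^n)}, layer_union n S -> cube_free n d S ->
     (#|S| <= #|Cset n d|)%N).
Proof.
move=> d0 le_dn; have n0 : (0 < n)%N by apply: leq_trans le_dn.
have In i : i \in Iidx d -> (i <= n)%N by move=> /Iidx_le le_id; apply: leq_trans le_dn.
split=> [a|S [J [JP SE]] free].
  move=> /subsetP sub; have cT : (d <= #|[set: 'I_d]|)%N by rewrite cardsT card_ord.
  have [J [_ J0 JP]] := Iidx_cube_free (fun i => val (a i)) d0 cT.
  have : \sum_(i in J) a i \in Cset n d by apply: sub; apply/imsetP; exists J; rewrite ?inE.
  by rewrite sum_val_Zp in_layers_natr // => /hasP[i /JP/negbTE->].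
(* The cube of the zero family is {0}, which is layer n + 1. *)
have lastJ : n.+1 \notin J.
  apply/negP => lastJ; apply: (free (fun=> 0)); apply/subsetP=> _ /imsetP[K _ ->].
  rewrite big1 // SE in_bigcup_seq; apply/hasP; exists n.+1 => //.
  by rewrite /layer eqxx inE.
(* Repeated indices in [J] must go before sizes are added up. *)
have undupJ : \bigcup_(i <- J) layer n i = \bigcup_(i <- undup J) layer n i.
  by apply/setP=> x; rewrite !in_bigcup_seq; apply: eq_has_r => i; rewrite mem_undup.
have Jn i : i \in undup J -> (0 < i <= n)%N.
  rewrite mem_undup => iJ; have /andP[-> le_in] := allP JP i iJ.
  by rewrite -ltnS ltn_neqAle le_in andbT; apply: contraNneq lastJ => <-.
move: free; rewrite SE undupJ => free.
rewrite /Cset !card_layers ?undup_uniq ?Iidx_uniq //; last first.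
  by move=> i iI; rewrite (Iidx_gt0 iI) In.
apply: Iidx_optimal; rewrite ?undup_uniq //.
by apply: cube_free_no_cube free => // i /Jn/andP[].
Qed.
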